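(* Let $\mathcal{T}'\in\mathbb{K}^{I_1\times I_2\times I_3}$ have multilinear rank $(R,R,K)$, and let $\mathcal{T}\in\mathbb{K}^{R\times R\times K}$ be an orthogonal compression of $\mathcal{T}'$. Then: (1) $\mathcal{T}'$ has $\mathbb{K}$-rank $R$ if and only if the JGE vectors of $\mathcal{T}$ span $\mathbb{K}^R$. Furthermore, if $\mathcal{T}=[\![\mathbf{A},\mathbf{B},\mathbf{C}]\!]$ has $\mathbb{K}$-rank $R$, then the JGE values of $\mathcal{T}$ are exactly the spans of the columns of $\mathbf{C}$, and the columns of $\mathbf{B}^{-\mathrm{T}}$ are JGE vectors of $\mathcal{T}$. (2) If $\mathcal{T}'$ has border $\mathbb{K}$-rank $R$ and $\mathcal{T}$ is simple, then $\mathcal{T}'$ has $\mathbb{K}$-rank $R$. (3) If $\mathcal{T}'$ has border $\mathbb{K}$-rank $R$ but $\mathbb{K}$-rank strictly greater than $R$, and $\mathcal{T}$ is slice mix invertible, then $\mathcal{T}$ has a JGE value $\mathscr{L}\subset\mathbb{K}^K$ with $\mathrm{am}(\mathscr{L})>\mathrm{gm}(\mathscr{L})\geq 1$.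
   Context: $\mathbb{K}$ denotes $\mathbb{R}$ or $\mathbb{C}$. A rank one tensor is $\mathbf{a}\otimes\mathbf{b}\otimes\mathbf{c}$ with nonzero vectors, $(\mathbf{a}\otimes\mathbf{b}\otimes\mathbf{c})_{ijk}=a_ib_jc_k$. The $\mathbb{K}$-rank of a tensor is the least number of rank one tensors with $\mathbb{K}$-valued factors summing to it; a minimal such sum $\sum_{r=1}^R\mathbf{a}_r\otimes\mathbf{b}_r\otimes\mathbf{c}_r$ is a CPD, written $[\![\mathbf{A},\mathbf{B},\mathbf{C}]\!]$ where $\mathbf{A},\mathbf{B},\mathbf{C}$ have columns $\mathbf{a}_r,\mathbf{b}_r,\mathbf{c}_r$. The border $\mathbb{K}$-rank is the least $R$ such that the tensor is a limit of tensors of $\mathbb{K}$-rank at most $R$. For $\mathcal{M}'\in\mathbb{K}^{I_1\times I_2\times I_3}$, $R_1(\mathcal{M}')=\dim\mathrm{span}\{\mathcal{M}'(:,k,\ell)\}$, $R_2(\mathcal{M}')=\dim\mathrm{span}\{\mathcal{M}'(j,:,\ell)\}$, $R_3(\mathcal{M}')=\dim\mathrm{span}\{\mathcal{M}'(j,k,:)\}$ (spans of mode-$1,2,3$ fibers); $(R_1,R_2,R_3)$ is the multilinear rank. The mode-$i$ product $\mathcal{M}'\cdot_i\mathbf{U}$ applies the matrix $\mathbf{U}$ to every mode-$i$ fiber. An orthogonal compression of $\mathcal{T}'$ with multilinear rank $(R,R,K)$ is $\mathcal{T}'\cdot_1\mathbf{V}_1^{\mathrm{H}}\cdot_2\mathbf{V}_2^{\mathrm{H}}\cdot_3\mathbf{V}_3^{\mathrm{H}}$,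 where $\mathbf{V}_i$ has orthonormal columns forming a basis of the span of the mode-$i$ fibers of $\mathcal{T}'$. For $\mathcal{T}\in\mathbb{K}^{R\times R\times K}$ let $\mathbf{T}_k=\mathcal{T}(:,:,k)$. $\mathcal{T}$ is slice mix invertible if some linear combination of $\mathbf{T}_1,\dots,\mathbf{T}_K$ is invertible. A nonzero $\mathbf{x}\in\mathbb{K}^R$ is a joint generalized eigenvector (JGE vector) of $\mathcal{T}$ if there are $\boldsymbol{\lambda}\in\mathbb{K}^K$ and nonzero $\mathbf{y}\in\mathbb{K}^R$ with $\mathbf{T}_\ell\mathbf{x}=\lambda_\ell\mathbf{y}$ for all $\ell=1,\dots,K$; then $\mathrm{span}(\boldsymbol{\lambda})$ is a JGE value and $(\mathrm{span}(\boldsymbol{\lambda}),\mathbf{x})$ a JGE pair. The characteristic polynomial is $p_{\mathcal{T}}(\boldsymbol{\gamma})=\det(\sum_{k=1}^K\gamma_k\mathbf{T}_k)$. For nonzero $\boldsymbol{\lambda}$, $\mathrm{am}(\mathrm{span}(\boldsymbol{\lambda}))$ is the largest $m$ such that $(\lambda_1\gamma_1+\cdots+\lambda_K\gamma_K)^m$ divides $p_{\mathcal{T}}$, and $\mathrm{gm}(\mathrm{span}(\boldsymbol{\lambda}))$ is the dimension of the span of the JGE vectors $\mathbf{x}$ for which $(\mathrm{span}(\boldsymbol{\lambda}),\mathbf{x})$ is a JGE pair. $\mathcal{T}$ is simple if it is slice mix invertible and $p_{\mathcal{T}}$ factors as a product of $R$ pairwise non-proportional linear forms (i.e. $R$ distinct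 JGE values each of algebraic multiplicity $1$). *)

(* Defs.v *)
(* K ranges over R (a realType) and C = R[i] (complex R). *)
From HB Require Import structures.
From mathcomp Require Import all_boot all_order all_algebra.
From mathcomp Require Import mpoly.
From mathcomp Require Import reals.
From mathcomp Require Import complex.

Set Implicit Arguments.
Unset Strict Implicit.
Unset Printing Implicit Defensive.

Import Order.TTheory GRing.Theory Num.Theory.
Local Open Scope ring_scope.

Section TensorDefs.
Variable K : numFieldType.
(* complex conjugation on K (the identity when K = R) *)
Variable conj : K -> K.

Definition tensor (I1 I2 I3 : nat) := 'I_I1 -> 'I_I2 -> 'I_I3 -> K.

Definition cpd I1 I2 I3 n (A : 'M[K]_(I1, n)) (B : 'M[K]_(I2, n))
  (C : 'M[K]_(I3, n)) : tensor I1 I2 I3 :=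
  fun i j k => \sum_(r < n) A i r * B j r * C k r.

Definition nz_cols m n (A : 'M[K]_(m, n)) := forall r, col r A != 0.

Definition sum_of_rank1 I1 I2 I3 (T : tensor I1 I2 I3) (n : nat) :=
  exists (A : 'M[K]_(I1, n)) (B : 'M[K]_(I2, n)) (C : 'M[K]_(I3, n)),
    [/\ nz_cols A, nz_cols B, nz_cols C & T = cpd A B C].

Definition krank I1 I2 I3 (T : tensor I1 I2 I3) (n : nat) :=
  sum_of_rank1 T n /\ forall m, sum_of_rank1 T m -> (n <= m)%N.

Definition tconv I1 I2 I3 (u : nat -> tensor I1 I2 I3) (T : tensor I1 I2 I3) :=
  forall e : K, 0 < e -> exists N, forall p, (N <= p)%N ->
    forall i j k, `|u p i j k - T i j k| < e.

Definition border_le I1 I2 I3 (T : tensor I1 I2 I3) (n : nat) :=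
  exists u : nat -> tensor I1 I2 I3,
    (forall p, exists r, (r <= n)%N /\ krank (u p) r) /\ tconv u T.

Definition border_rank I1 I2 I3 (T : tensor I1 I2 I3) (n : nat) :=
  border_le T n /\ forall m, border_le T m -> (n <= m)%N.

Definition fiber_span1 I1 I2 I3 (T : tensor I1 I2 I3) : 'M[K]_I1 :=
  (\sum_(j < I2) \sum_(l < I3) <<\row_i T i j l>>)%MS.
Definition fiber_span2 I1 I2 I3 (T : tensor I1 I2 I3) : 'M[K]_I2 :=
  (\sum_(i < I1) \sum_(l < I3) <<\row_j T i j l>>)%MS.
Definition fiber_span3 I1 I2 I3 (T : tensor I1 I2 I3) : 'M[K]_I3 :=
  (\sum_(i < I1) \sum_(j < I2) <<\row_l T i j l>>)%MS.

Definition mlrank I1 I2 I3 (T : tensor I1 I2 I3) (r1 r2 r3 : nat) :=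
  [/\ \rank (fiber_span1 T) = r1, \rank (fiber_span2 T) = r2
    & \rank (fiber_span3 T) = r3].

Definition mode1 I1 I2 I3 J (T : tensor I1 I2 I3) (U : 'M[K]_(J, I1))
  : tensor J I2 I3 := fun a j l => \sum_(i < I1) U a i * T i j l.
Definition mode2 I1 I2 I3 J (T : tensor I1 I2 I3) (U : 'M[K]_(J, I2))
  : tensor I1 J I3 := fun i a l => \sum_(j < I2) U a j * T i j l.
Definition mode3 I1 I2 I3 J (T : tensor I1 I2 I3) (U : 'M[K]_(J, I3))
  : tensor I1 I2 J := fun i j a => \sum_(l < I3) U a l * T i j l.

Definition adjH m n (V : 'M[K]_(m, n)) : 'M[K]_(n, m) := map_mx conj V^T.

Definition orth_basis_of m n (V : 'M[K]_(m, n)) (S : 'M[K]_m) :=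
  adjH V *m V = 1%:M /\ (V^T == S)%MS.

Definition compression I1 I2 I3 J1 J2 J3 (T' : tensor I1 I2 I3)
  (V1 : 'M[K]_(I1, J1)) (V2 : 'M[K]_(I2, J2)) (V3 : 'M[K]_(I3, J3))
  : tensor J1 J2 J3 :=
  mode3 (mode2 (mode1 T' (adjH V1)) (adjH V2)) (adjH V3).

Definition slice R Kd (T : tensor R R Kd) (k : 'I_Kd) : 'M[K]_R :=
  \matrix_(i, j) T i j k.

Definition slice_mix_invertible R Kd (T : tensor R R Kd) :=
  exists g : 'I_Kd -> K, \sum_(k < Kd) g k *: slice T k \in unitmx.

Definition jge_pair R Kd (T : tensor R R Kd) (lam : 'rV[K]_Kd) (x : 'cV[K]_R) :=
  x != 0 /\ exists y : 'cV[K]_R,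
    y != 0 /\ forall l, slice T l *m x = lam 0 l *: y.

Definition jge_vector R Kd (T : tensor R R Kd) (x : 'cV[K]_R) :=
  exists lam, jge_pair T lam x.

Definition jge_value R Kd (T : tensor R R Kd) p (L : 'M[K]_(p, Kd)) :=
  exists lam x, jge_pair T lam x /\ (L == lam)%MS.

Definition jge_vectors_span R Kd (T : tensor R R Kd) :=
  forall v : 'cV[K]_R, exists n (xs : 'I_n -> 'cV[K]_R) (c : 'I_n -> K),
    (forall i, jge_vector T (xs i)) /\ v = \sum_(i < n) c i *: xs i.

Definition charpoly R Kd (T : tensor R R Kd) : {mpoly K[Kd]} :=
  \det (\matrix_(i, j) \sum_(k < Kd) (T i j k)%:MP * 'X_k).

Definition linform Kd (lam : 'rV[K]_Kd) : {mpoly K[Kd]} :=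
  \sum_(k < Kd) (lam 0 k)%:MP * 'X_k.

Definition mdvd Kd (p q : {mpoly K[Kd]}) := exists r, q = r * p.

Definition am R Kd (T : tensor R R Kd) (lam : 'rV[K]_Kd) (m : nat) :=
  mdvd (linform lam ^+ m) (charpoly T) /\
  ~ mdvd (linform lam ^+ m.+1) (charpoly T).

Definition jge_vector_for R Kd (T : tensor R R Kd) (lam : 'rV[K]_Kd) x :=
  exists lam', jge_pair T lam' x /\ (lam' == lam)%MS.

(* gm(span lam) = g : the span of those JGE vectors has dimension g
   (it has a basis X of g vectors taken from that set) *)
Definition gm R Kd (T : tensor R R Kd) (lam : 'rV[K]_Kd) (g : nat) :=
  exists X : 'M[K]_(g, R),
    [/\ row_free X,
        forall i, jge_vector_for T lam (row i X)^T
      & forall x, jge_vector_for T lam x -> (x^T <= X)%MS].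

Definition simple R Kd (T : tensor R R Kd) :=
  slice_mix_invertible T /\
  exists ls : 'I_R -> 'rV[K]_Kd,
    charpoly T = \prod_(r < R) linform (ls r) /\
    forall r s, r != s -> ~~ (ls r <= ls s)%MS.

Definition theorem2p3_for :=
  forall (I1 I2 I3 R Kd : nat) (T' : tensor I1 I2 I3)
    (V1 : 'M[K]_(I1, R)) (V2 : 'M[K]_(I2, R)) (V3 : 'M[K]_(I3, Kd)),
  mlrank T' R R Kd ->
  orth_basis_of V1 (fiber_span1 T') ->
  orth_basis_of V2 (fiber_span2 T') ->
  orth_basis_of V3 (fiber_span3 T') ->
  let T := compression T' V1 V2 V3 in
  ((krank T' R <-> jge_vectors_span T) /\
   (forall (A B : 'M[K]_(R, R)) (C : 'M[K]_(Kd, R)),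
      krank T R -> T = cpd A B C ->
      (forall L : 'M[K]_Kd, jge_value T L <-> exists r, (L == (col r C)^T)%MS)
      /\ (forall r, jge_vector T (col r (invmx B)^T)))) /\
  (border_rank T' R -> simple T -> krank T' R) /\
  (border_rank T' R -> (exists n, krank T' n /\ (R < n)%N) ->
   slice_mix_invertible T ->
   exists (lam : 'rV[K]_Kd) (m g : nat),
     [/\ lam != 0, jge_value T lam, am T lam m, gm T lam g
       & (1 <= g < m)%N]).

End TensorDefs.

(* Main.v *)
Require Import Defs.
From HB Require Import structures.
From mathcomp Require Import all_boot all_order all_algebra.
From mathcomp Require Import mpoly.
From mathcomp Require Import boolp.
From mathcomp Require Import reals.
From mathcomp Require Import complex.

(** The compression [T] determines [T'] and its slices have no common left or
    right kernel, so a decomposition of [T] into [R] terms is the same thing as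
    a basis of joint generalized eigenvectors; this is part (1).

    Let [M] be an invertible combination of the slices.  If [T] is a limit of
    tensors with slices [A D_k B^T] ([D_k] diagonal), then
    [T_k adj(M) T_l = T_l adj(M) T_k], so the matrices [N_k = M^-1 T_k] commute;
    their characteristic polynomials split over [K], which for real [K] also
    comes from the limit.  Suppose the joint eigenvectors of the [N_k] do not
    span.  A joint eigenvector modulo their span can be corrected to a vector
    [v] outside the joint eigenspace [E] of some [nu] such that all
    [(N_k - nu_k) v] lie in [E].  Then [E <> 0], and [nu], viewed as a linear
    form, divides the characteristic polynomial at least [dim E + 1] times,
    i.e. [am > gm >= 1].  This proves (3), and (2) because for a simple tensor no
    linear form divides the characteristic polynomial twice. *)

Import Order.TTheory GRing.Theory Num.Theory.
Local Open Scope ring_scope.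
Set Implicit Arguments.
Unset Strict Implicit.
Unset Printing Implicit Defensive.

(** * Limits of scalars and matrices *)

Definition cvgs (K : numFieldType) (u : nat -> K) (l : K) :=
  forall e : K, 0 < e -> exists N, forall p, (N <= p)%N -> `|u p - l| < e.

Section Convergence.
Variable K : numFieldType.
Implicit Types (u v : nat -> K) (l : K).

Lemma cvgs_ext u v l : u =1 v -> cvgs u l -> cvgs v l.
Proof. by move=> uv ul e /ul[N uN]; exists N => p /uN; rewrite uv. Qed.

Lemma cvgs_cst l : cvgs (fun=> l) l.
Proof. by move=> e e0; exists 0 => p _; rewrite subrr normr0. Qed.

Lemma cvgsD u v l m : cvgs u l -> cvgs v m -> cvgs (fun p => u p + v p) (l + m).
Proof.
move=> ul vm e e0; have e2 : 0 < e / 2 by rewrite divr_gt0.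
have [N1 h1] := ul _ e2; have [N2 h2] := vm _ e2.
exists (maxn N1 N2) => p; rewrite geq_max => /andP[/h1 u1 /h2 u2].
rewrite opprD addrACA (le_lt_trans (ler_normD _ _))//.
by rewrite [e]splitr ltrD.
Qed.

Lemma cvgsM u v l m : cvgs u l -> cvgs v m -> cvgs (fun p => u p * v p) (l * m).
Proof.
move=> ul vm e e0; have e2 : 0 < e / 2 by rewrite divr_gt0.
have pos (x : K) : 0 < 1 + `|x| by rewrite ltr_pwDl.
have [N1 h1] := ul _ (divr_gt0 e2 (pos m)).
have [N2 h2] := vm _ ltr01.
have [N3 h3] := vm _ (divr_gt0 e2 (pos l)).
exists (maxn N1 (maxn N2 N3)) => p.
rewrite !geq_max => /andP[/h1 u1 /andP[/h2 v2 /h3 v3]].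
have -> : u p * v p - l * m = (u p - l) * v p + l * (v p - m).
  by rewrite mulrBl mulrBr addrA subrK.
rewrite (le_lt_trans (ler_normD _ _))// !normrM [e]splitr ltr_leD//; last first.
  apply: (@le_trans _ _ ((1 + `|l|) * (e / 2 / (1 + `|l|)))).
    by apply: ler_pM => //; [rewrite lerDr | exact: ltW].
  by rewrite mulrC divfK// gt_eqF.
have vb : `|v p| <= 1 + `|m|.
  rewrite -[v p](subrK m) (le_trans (ler_normD _ _))// lerD2r.
  exact: ltW.
apply: le_lt_trans (_ : `|u p - l| * (1 + `|m|) < _).
  exact: ler_wpM2l.
by rewrite -ltr_pdivlMr.
Qed.

Lemma cvgsN u l : cvgs u l -> cvgs (fun p => - u p) (- l).
Proof.
move=> /(cvgsM (cvgs_cst (-1))); rewrite mulN1r; apply: cvgs_ext => p.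
by rewrite mulN1r.
Qed.

Lemma cvgs_sum (I : Type) (r : seq I) (P : pred I) (u : nat -> I -> K)
    (l : I -> K) : (forall i, cvgs (u^~ i) (l i)) ->
  cvgs (fun p => \sum_(i <- r | P i) u p i) (\sum_(i <- r | P i) l i).
Proof.
move=> ul; elim: r => [|i r IH].
  by rewrite big_nil; apply: cvgs_ext (cvgs_cst _) => p; rewrite big_nil.
rewrite big_cons; case: (boolP (P i)) => Pi; last first.
  by apply: cvgs_ext IH => p; rewrite big_cons (negPf Pi).
by apply: cvgs_ext (cvgsD (ul i) IH) => p; rewrite big_cons Pi.
Qed.

Lemma cvgs_prod (I : Type) (r : seq I) (P : pred I) (u : nat -> I -> K)
    (l : I -> K) : (forall i, cvgs (u^~ i) (l i)) ->
  cvgs (fun p => \prod_(i <- r | P i) u p i) (\prod_(i <- r | P i) l i).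
Proof.
move=> ul; elim: r => [|i r IH].
  by rewrite big_nil; apply: cvgs_ext (cvgs_cst _) => p; rewrite big_nil.
rewrite big_cons; case: (boolP (P i)) => Pi; last first.
  by apply: cvgs_ext IH => p; rewrite big_cons (negPf Pi).
by apply: cvgs_ext (cvgsM (ul i) IH) => p; rewrite big_cons Pi.
Qed.

Lemma cvgs_eq0 u l : cvgs u l -> cvgs u 0 -> l = 0.
Proof.
move=> ul u0; have /(_ `|l|) := cvgsD u0 (cvgsN ul).
rewrite add0r normr_gt0; case: eqVneq => // _ /(_ isT)[N /(_ _ (leqnn _))].
by rewrite subrr sub0r opprK ltxx.
Qed.

Lemma cvgs_eventually0 u N : (forall p, (N <= p)%N -> u p = 0) -> cvgs u 0.
Proof. by move=> h e e0; exists N => p /h ->; rewrite subrr normr0. Qed.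

Lemma cvgs_eventually_neq0 u l : cvgs u l -> l != 0 ->
  exists N, forall p, (N <= p)%N -> u p != 0.
Proof.
rewrite -normr_gt0 => ul /ul[N h]; exists N => p /h.
by apply: contraTneq => ->; rewrite sub0r normrN ltxx.
Qed.

Definition cvgm m n (A : nat -> 'M[K]_(m, n)) (L : 'M[K]_(m, n)) :=
  forall i j, cvgs (fun p => A p i j) (L i j).

Lemma cvgm_mul m n q (A : nat -> 'M[K]_(m, n)) (B : nat -> 'M[K]_(n, q)) L M :
  cvgm A L -> cvgm B M -> cvgm (fun p => A p *m B p) (L *m M).
Proof.
move=> AL BM i j; rewrite mxE.
apply: cvgs_ext (_ : cvgs (fun p => \sum_k A p i k * B p k j) _) => [p|].
  by rewrite mxE.
by apply: cvgs_sum => k; apply: cvgsM.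
Qed.

Lemma cvgm_det n (A : nat -> 'M[K]_n) L :
  cvgm A L -> cvgs (fun p => \det (A p)) (\det L).
Proof.
move=> AL; apply: cvgs_sum => s; apply: cvgsM; first exact: cvgs_cst.
by apply: cvgs_prod => i; apply: AL.
Qed.

Lemma cvgm_adj n (A : nat -> 'M[K]_n) L :
  cvgm A L -> cvgm (fun p => \adj (A p)) (\adj L).
Proof.
move=> AL i j; rewrite mxE.
apply: cvgs_ext (_ : cvgs (fun p => cofactor (A p) j i) _) => [p|].
  by rewrite mxE.
apply: cvgsM; first exact: cvgs_cst.
apply: cvgm_det => k l; rewrite !mxE.
by apply: cvgs_ext (AL _ _) => p; rewrite !mxE.
Qed.

Lemma cvgm_sumZ m n (I : finType) (g : I -> K) (A : nat -> I -> 'M[K]_(m, n))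
    (L : I -> 'M[K]_(m, n)) : (forall k, cvgm (A^~ k) (L k)) ->
  cvgm (fun p => \sum_k g k *: A p k) (\sum_k g k *: L k).
Proof.
move=> AL i j; rewrite summxE.
apply: cvgs_ext (_ : cvgs (fun p => \sum_k g k * A p k i j) _) => [p|].
  by rewrite summxE; apply: eq_bigr => k _; rewrite mxE.
apply: cvgs_sum => k; rewrite mxE; apply: cvgsM; first exact: cvgs_cst.
exact: AL.
Qed.

End Convergence.

(** * Mode products, fiber spans and their effect on decompositions *)

Section Modes.
Variable K : numFieldType.

Lemma eq_tensor I1 I2 I3 (S T : tensor K I1 I2 I3) :
  (forall i j l, S i j l = T i j l) -> S = T.
Proof. by move=> h; do 3 (apply: funext => ?). Qed.

Lemma fiber1_sub I1 I2 I3 (T : tensor K I1 I2 I3) j l :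
  (\row_i T i j l <= fiber_span1 T)%MS.
Proof. by apply: (sumsmx_sup j) => //; apply: (sumsmx_sup l); rewrite ?genmxE. Qed.

Lemma fiber2_sub I1 I2 I3 (T : tensor K I1 I2 I3) i l :
  (\row_j T i j l <= fiber_span2 T)%MS.
Proof. by apply: (sumsmx_sup i) => //; apply: (sumsmx_sup l); rewrite ?genmxE. Qed.

Lemma fiber3_sub I1 I2 I3 (T : tensor K I1 I2 I3) i j :
  (\row_l T i j l <= fiber_span3 T)%MS.
Proof. by apply: (sumsmx_sup i) => //; apply: (sumsmx_sup j); rewrite ?genmxE. Qed.

Lemma mul_fiber_span1 I1 I2 I3 J (T : tensor K I1 I2 I3) (Z : 'M_(I1, J)) :
  (forall j l, \row_i T i j l *m Z = 0) -> fiber_span1 T *m Z = 0.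
Proof.
move=> h; apply/sub_kermxP; apply/sumsmx_subP => j _; apply/sumsmx_subP => l _.
by rewrite genmxE; apply/sub_kermxP.
Qed.

Lemma mul_fiber_span2 I1 I2 I3 J (T : tensor K I1 I2 I3) (Z : 'M_(I2, J)) :
  (forall i l, \row_j T i j l *m Z = 0) -> fiber_span2 T *m Z = 0.
Proof.
move=> h; apply/sub_kermxP; apply/sumsmx_subP => i _; apply/sumsmx_subP => l _.
by rewrite genmxE; apply/sub_kermxP.
Qed.

(** Since [U *m V = 1%:M], the matrix [V *m U] is a projector onto the column span of [V] and fixes
    every fiber lying there. *)
Lemma proj_fiber I r (V : 'M[K]_(I, r)) (U : 'M[K]_(r, I)) (f : 'I_I -> K) :
  U *m V = 1%:M -> (\row_i f i <= V^T)%MS ->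
  forall i, \sum_k (V *m U) i k * f k = f i.
Proof.
move=> UV /submxP[w fw] i.
transitivity ((\row_i f i *m (V *m U)^T) 0 i).
  by rewrite mxE; apply: eq_bigr => k _; rewrite !mxE mulrC.
by rewrite fw -mulmxA -trmx_mul -mulmxA UV mulmx1 -fw mxE.
Qed.

Lemma mode1_proj I1 I2 I3 r (T : tensor K I1 I2 I3) (V : 'M_(I1, r)) (U : 'M_(r, I1)) :
  U *m V = 1%:M -> (V^T == fiber_span1 T)%MS -> mode1 T (V *m U) = T.
Proof.
move=> UV /andP[_ TV]; apply: eq_tensor => i j l.
exact: (proj_fiber UV (submx_trans (fiber1_sub T j l) TV)).
Qed.

Lemma mode2_proj I1 I2 I3 r (T : tensor K I1 I2 I3) (V : 'M_(I2, r)) (U : 'M_(r, I2)) :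
  U *m V = 1%:M -> (V^T == fiber_span2 T)%MS -> mode2 T (V *m U) = T.
Proof.
move=> UV /andP[_ TV]; apply: eq_tensor => i j l.
exact: (proj_fiber UV (submx_trans (fiber2_sub T i l) TV)).
Qed.

Lemma mode3_proj I1 I2 I3 r (T : tensor K I1 I2 I3) (V : 'M_(I3, r)) (U : 'M_(r, I3)) :
  U *m V = 1%:M -> (V^T == fiber_span3 T)%MS -> mode3 T (V *m U) = T.
Proof.
move=> UV /andP[_ TV]; apply: eq_tensor => i j l.
exact: (proj_fiber UV (submx_trans (fiber3_sub T i j) TV)).
Qed.

Lemma exch_sum m n (a : 'I_m -> K) (b : 'I_n -> K) (f : 'I_m -> 'I_n -> K) :
  \sum_i a i * (\sum_j b j * f i j) = \sum_j b j * (\sum_i a i * f i j).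
Proof.
under eq_bigr do rewrite mulr_sumr; rewrite exchange_big /=.
by apply: eq_bigr => j _; rewrite mulr_sumr; apply: eq_bigr => i _; rewrite mulrCA.
Qed.

Lemma mul_sum m n q (U : 'M[K]_(m, n)) (V : 'M[K]_(n, q)) (f : 'I_q -> K) i :
  \sum_j U i j * (\sum_k V j k * f k) = \sum_k (U *m V) i k * f k.
Proof.
under eq_bigr do rewrite mulr_sumr; rewrite exchange_big /=.
apply: eq_bigr => k _; rewrite mxE mulr_suml.
by apply: eq_bigr => j _; rewrite mulrA.
Qed.

Section ModeComposition.
Variables (I1 I2 I3 J1 J2 : nat) (T : tensor K I1 I2 I3).

Lemma mode12 (U : 'M_(J1, I1)) (V : 'M_(J2, I2)) :
  mode1 (mode2 T V) U = mode2 (mode1 T U) V.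
Proof. by apply: eq_tensor => i j l; rewrite /mode1 /mode2 exch_sum. Qed.

Lemma mode13 (U : 'M_(J1, I1)) (V : 'M_(J2, I3)) :
  mode1 (mode3 T V) U = mode3 (mode1 T U) V.
Proof. by apply: eq_tensor => i j l; rewrite /mode1 /mode3 exch_sum. Qed.

Lemma mode23 (U : 'M_(J1, I2)) (V : 'M_(J2, I3)) :
  mode2 (mode3 T V) U = mode3 (mode2 T U) V.
Proof. by apply: eq_tensor => i j l; rewrite /mode2 /mode3 exch_sum. Qed.

Lemma mode11 (U : 'M_(J1, I1)) (V : 'M_(J2, J1)) :
  mode1 (mode1 T U) V = mode1 T (V *m U).
Proof. by apply: eq_tensor => i j l; rewrite /mode1 mul_sum. Qed.

Lemma mode22 (U : 'M_(J1, I2)) (V : 'M_(J2, J1)) :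
  mode2 (mode2 T U) V = mode2 T (V *m U).
Proof. by apply: eq_tensor => i j l; rewrite /mode2 mul_sum. Qed.

Lemma mode33 (U : 'M_(J1, I3)) (V : 'M_(J2, J1)) :
  mode3 (mode3 T U) V = mode3 T (V *m U).
Proof. by apply: eq_tensor => i j l; rewrite /mode3 mul_sum. Qed.

End ModeComposition.

Section CpdModes.
Variables (I1 I2 I3 J n : nat).
Variables (A : 'M[K]_(I1, n)) (B : 'M[K]_(I2, n)) (C : 'M[K]_(I3, n)).

Lemma mode1_cpd (U : 'M_(J, I1)) : mode1 (cpd A B C) U = cpd (U *m A) B C.
Proof.
apply: eq_tensor => i j l; rewrite /mode1 /cpd.
under eq_bigr do rewrite mulr_sumr; rewrite exchange_big /=.
apply: eq_bigr => r _; rewrite mxE !mulr_suml.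
by apply: eq_bigr => k _; rewrite !mulrA.
Qed.

Lemma mode2_cpd (U : 'M_(J, I2)) : mode2 (cpd A B C) U = cpd A (U *m B) C.
Proof.
apply: eq_tensor => i j l; rewrite /mode2 /cpd.
under eq_bigr do rewrite mulr_sumr; rewrite exchange_big /=.
apply: eq_bigr => r _; rewrite mxE mulr_sumr mulr_suml.
by apply: eq_bigr => k _; rewrite !mulrA [U _ _ * _]mulrC.
Qed.

Lemma mode3_cpd (U : 'M_(J, I3)) : mode3 (cpd A B C) U = cpd A B (U *m C).
Proof.
apply: eq_tensor => i j l; rewrite /mode3 /cpd.
under eq_bigr do rewrite mulr_sumr; rewrite exchange_big /=.
apply: eq_bigr => r _; rewrite mxE mulr_sumr.
by apply: eq_bigr => k _; rewrite mulrCA.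
Qed.

End CpdModes.

Lemma slice_cpd R Kd n (A B : 'M[K]_(R, n)) (C : 'M[K]_(Kd, n)) k :
  slice (cpd A B C) k = A *m diag_mx (row k C) *m B^T.
Proof.
apply/matrixP => i j; rewrite mul_mx_diag !mxE; apply: eq_bigr => r _.
by rewrite !mxE mulrAC.
Qed.

Lemma eq_slices R Kd (S T : tensor K R R Kd) :
  (forall k, slice S k = slice T k) -> S = T.
Proof.
by move=> h; apply: eq_tensor => i j k; have /matrixP/(_ i j) := h k; rewrite !mxE.
Qed.

(** Zero columns are allowed in [cpd], so approximants of rank below [n] can all be given factors
    with exactly [n] columns. *)
Lemma cpd_pad I1 I2 I3 r n (A : 'M[K]_(I1, r)) (B : 'M[K]_(I2, r))
    (C : 'M[K]_(I3, r)) : (r <= n)%N ->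
  exists A' B' C', cpd A B C = cpd A' B' (C' : 'M[K]_(I3, n)).
Proof.
move=> /subnKC <-; set t := (n - r)%N.
exists (row_mx A (0 : 'M_(_, t))), (row_mx B (0 : 'M_(_, t))), (row_mx C (0 : 'M_(_, t))).
apply: eq_tensor => i j k; rewrite /cpd big_split_ord /= [X in _ + X]big1.
  by rewrite addr0; apply: eq_bigr => s _; rewrite !row_mxEl.
by move=> s _; rewrite !row_mxEr !mxE !mul0r.
Qed.

(** Every mode-1 fiber is a combination of the columns of [A]. This bound makes a decomposition of
    [T'] into [R] terms minimal. *)
Lemma mlrank1_le I1 I2 I3 (T : tensor K I1 I2 I3) m :
  sum_of_rank1 T m -> (\rank (fiber_span1 T) <= m)%N.
Proof.
move=> [A [B [C [_ _ _ TE]]]].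
suff /mxrankS/leq_trans TA : (fiber_span1 T <= A^T)%MS by apply/TA/rank_leq_row.
apply/sumsmx_subP => j _; apply/sumsmx_subP => l _; rewrite genmxE.
apply/submxP; exists (\row_r (B j r * C l r)); apply/rowP => i.
by rewrite !mxE TE; apply: eq_bigr => r _; rewrite !mxE -mulrA mulrC.
Qed.

End Modes.

(** * Joint generalized eigenvectors and decompositions into [R] terms *)

Section JointEigenvectors.
Variable K : numFieldType.

Definition nondegenerate_l R Kd (T : tensor K R R Kd) :=
  forall y : 'rV_R, (forall k, y *m slice T k = 0) -> y = 0.
Definition nondegenerate_r R Kd (T : tensor K R R Kd) :=
  forall x : 'cV_R, (forall k, slice T k *m x = 0) -> x = 0.

Lemma col_mul m n q (A : 'M[K]_(m, n)) (B : 'M[K]_(n, q)) r :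
  col r (A *m B) = A *m col r B.
Proof. by rewrite !colE mulmxA. Qed.

Lemma row_free_col_mx s n (X : 'M[K]_(s, n)) (x : 'rV[K]_n) :
  row_free X -> ~~ (x <= X)%MS -> row_free (col_mx X x).
Proof.
move=> fX xX; apply: inj_row_free => v; rewrite -[v]hsubmxK mul_row_col.
move: (lsubmx v) (rsubmx v) => a b; have [->|b0] := eqVneq b 0.
  rewrite mul0mx addr0 => /(congr1 (mulmxr (pinvmx X))) /=.
  by rewrite mulmxKp// mul0mx => ->; rewrite row_mx0.
move=> /eqP; rewrite addrC addr_eq0 [b]mx11_scalar mul_scalar_mx => /eqP bx.
case/negP: xX; rewrite -[x](@scalerK _ _ (b 0 0)) ?bx.
  by rewrite scalemx_sub// -mulNmx submxMl.
by apply: contra b0 => /eqP b0; rewrite [b]mx11_scalar b0 raddf0.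
Qed.

(** Free families have at most [n] rows, so a largest one exists; a vector satisfying [P] outside
    its span would enlarge it. [P] is arbitrary, hence the classical truth value in [Q]. *)
Lemma ex_max_free n (P : 'rV[K]_n -> Prop) :
  exists s (X : 'M[K]_(s, n)),
    [/\ row_free X, forall i, P (row i X) & forall x, P x -> (x <= X)%MS].
Proof.
pose Q s := `[< exists X : 'M[K]_(s, n), row_free X /\ forall i, P (row i X) >].
have Q0 : exists s, Q s.
  exists 0%N; apply/asboolP; exists 0; split=> [|[]//].
  by rewrite /row_free mxrank0.
have Qn s : Q s -> (s <= n)%N.
  by move=> /asboolP[X [fX _]]; rewrite -(eqP fX) rank_leq_col.
case: (ex_maxnP Q0 Qn) => s /asboolP[X [fX PX]] smax.
exists s, X; split=> // x Px; apply: contraT => xX.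
suff /smax : Q (s + 1)%N by rewrite addn1 ltnn.
apply/asboolP; exists (col_mx X x); split; last first.
  move=> i; case: (splitP i) => j ij.
    by have -> : i = lshift 1 j by [apply: val_inj]; rewrite rowKu.
  by have -> : i = rshift s j by [apply: val_inj]; rewrite rowKd ord1 row_id.
exact: row_free_col_mx.
Qed.

Section Cpd.
Variables (R Kd : nat) (A B : 'M[K]_R) (C : 'M[K]_(Kd, R)).
Let T := cpd A B C.

Lemma cpd_unitl : nondegenerate_l T -> A \in unitmx.
Proof.
move=> nd; rewrite -row_free_unit; apply: inj_row_free => y yA.
by apply: nd => k; rewrite slice_cpd -mulmxA mulmxA yA mul0mx.
Qed.

Lemma cpd_unitr : nondegenerate_r T -> B \in unitmx.
Proof.
move=> nd; rewrite -row_free_unit; apply: inj_row_free => y yB.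
apply: trmx_inj; rewrite trmx0; apply: nd => k.
by rewrite slice_cpd -mulmxA -trmx_mul yB trmx0 mulmx0.
Qed.

Hypotheses (uA : A \in unitmx) (uB : B \in unitmx).

(** The factor [B^T] turns column [r] of [(invmx B)^T] into a unit vector, which the diagonal factor
    scales by [C k r]. *)
Lemma slice_cpd_invB k r :
  slice T k *m col r (invmx B)^T = C k r *: col r A.
Proof.
rewrite slice_cpd -mulmxA -!col_mul -trmx_mul mulVmx// trmx1 mulmx1.
by apply/colP => i; rewrite mul_mx_diag !mxE mulrC.
Qed.

Lemma unit_col_neq0 (M : 'M[K]_R) r : M \in unitmx -> col r M != 0.
Proof.
move=> uM; apply/eqP => /(congr1 (mulmx (invmx M))).
rewrite -col_mul mulVmx// mulmx0 => /colP/(_ r)/eqP.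
by rewrite !mxE eqxx oner_eq0.
Qed.

Lemma cpd_jge_pair r : jge_pair T (col r C)^T (col r (invmx B)^T).
Proof.
split; first by rewrite unit_col_neq0// unitmx_tr unitmx_inv.
exists (col r A); split; first exact: unit_col_neq0.
by move=> k; rewrite slice_cpd_invB !mxE.
Qed.

Lemma cpd_jge_vectors_span : jge_vectors_span T.
Proof.
move=> v; exists R, (fun r => col r (invmx B)^T), (fun r => (B^T *m v) r 0); split.
  by move=> r; exists (col r C)^T; exact: cpd_jge_pair.
transitivity ((invmx B)^T *m (B^T *m v)).
  by rewrite mulmxA -trmx_mul mulmxV// trmx1 mul1mx.
apply/colP => i; rewrite mxE summxE; apply: eq_bigr => r _.
by rewrite !mxE mulrC.
Qed.

Lemma cpd_jge_value (nd : nondegenerate_r T) p (L : 'M[K]_(p, Kd)) :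
  jge_value T L <-> exists r, (L == (col r C)^T)%MS.
Proof.
split=> [[lam [x [[x0 [y [y0 xy]]] Llam]]]|[r Lr]]; last first.
  by exists (col r C)^T, (col r (invmx B)^T); split=> //; apply: cpd_jge_pair.
(* In the coordinates [B^T *m x] and [invmx A *m y] the slices act diagonally; an index where [x]
   has a nonzero coordinate singles out a column of [C] proportional to [lam]. *)
have [r zr] : exists r, (B^T *m x) r 0 != 0.
  apply/existsP; apply: contraNT x0; rewrite negb_exists => /forallP z0.
  have : B^T *m x = 0.
    by apply/colP => r; rewrite [RHS]mxE; apply/eqP; rewrite -[_ == _]negbK.
  by move=> /(congr1 (mulmx (invmx B^T))); rewrite mulKmx ?unitmx_tr// mulmx0 => ->.
pose z := (B^T *m x) r 0; pose w := (invmx A *m y) r 0.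
have cz k : C k r * z = lam 0 k * w.
  have /(congr1 (mulmx (invmx A))) := xy k.
  rewrite slice_cpd -!mulmxA mulKmx// -scalemxAr /z /w.
  by move: (B^T *m x) (invmx A *m y) => b a /colP/(_ r); rewrite mul_diag_mx !mxE.
(* A zero column of [C] would put a column of [(invmx B)^T] in the kernel of all slices. *)
have c0 : col r C != 0.
  apply: contraTneq (cpd_jge_pair r).1 => cr0; rewrite negbK; apply/eqP/nd => k.
  by rewrite slice_cpd_invB; have /colP/(_ k) := cr0; rewrite !mxE => ->; rewrite scale0r.
have w0 : w != 0.
  apply: contraNneq c0 => w0; apply/eqP/colP => k; rewrite !mxE; apply/eqP.
  by have /eqP := cz k; rewrite w0 mulr0 mulf_eq0 (negPf zr) orbF.
have cE : (col r C)^T = (w / z) *: lam.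
  apply/rowP => k; rewrite !mxE mulrAC [w * _]mulrC -cz.
  by rewrite mulfK.
exists r; rewrite cE; apply/eqmxP; apply: (eqmx_trans (eqmxP Llam)).
by apply/eqmx_sym/eqmx_scale; rewrite mulf_neq0// invr_eq0.
Qed.

End Cpd.

(** With a basis of JGE vectors as columns of [X^T], the defining equations read
    [T_k *m X^T = Y *m D_k] with [D_k] diagonal; inverting [X^T] gives the decomposition.
    Nondegeneracy keeps the columns of [C] nonzero. *)
Lemma jge_vectors_span_cpd R Kd (T : tensor K R R Kd) :
  nondegenerate_r T -> jge_vectors_span T -> sum_of_rank1 T R.
Proof.
move=> nd sp.
have [s [X [fX jX maxX]]] := ex_max_free (fun x : 'rV_R => jge_vector T x^T).
have {sp maxX} fullX : row_full X.
  rewrite -sub1mx; apply/row_subP => i.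
  have [n [xs [c [jxs e]]]] := sp (row i 1%:M)^T.
  rewrite -[row i _]trmxK e linear_sum /=.
  apply: summx_sub => r _; rewrite linearZ scalemx_sub//.
  by apply: maxX; rewrite trmxK.
have sR : s = R by rewrite -(eqP fX) (eqP fullX).
subst s; have {fX fullX} uX : X^T \in unitmx by rewrite unitmx_tr -row_free_unit.
have [lam jX1] := fin_all_exists jX.
have [y jX2] := fin_all_exists (fun r => (jX1 r).2).
pose Y := \matrix_(i, r) y r i 0.
pose C := \matrix_(k, r) lam r 0 k.
pose B := (invmx X^T)^T.
have TE : T = cpd Y B C.
  apply: eq_slices => k; rewrite slice_cpd trmxK.
  apply: (canRL (mulmxK uX)); apply/matrixP => i r.
  rewrite mul_mx_diag !mxE mulrC.
  have /colP/(_ i) := (jX2 r).2 k; rewrite !mxE => <-.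
  by apply: eq_bigr => j _; rewrite !mxE.
have colY r : col r Y = y r by apply/colP => i; rewrite !mxE.
have uB : B \in unitmx by rewrite unitmx_tr unitmx_inv.
exists Y, B, C; split=> // r.
- by rewrite colY (jX2 r).1.
- exact: unit_col_neq0.
apply/eqP => cr0; have /eqP := (jX1 r).1; apply; apply: nd => k.
rewrite (jX2 r).2; have /colP/(_ k) := cr0; rewrite !mxE => ->.
by rewrite scale0r.
Qed.

End JointEigenvectors.

(** * Passing between [T'] and its compression *)

Section Compression.
Variables (K : numFieldType) (conj : K -> K).
Variables (I1 I2 I3 R Kd : nat) (T' : tensor K I1 I2 I3).
Variables (V1 : 'M[K]_(I1, R)) (V2 : 'M[K]_(I2, R)) (V3 : 'M[K]_(I3, Kd)).
Hypotheses (o1 : orth_basis_of conj V1 (fiber_span1 T'))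
  (o2 : orth_basis_of conj V2 (fiber_span2 T'))
  (o3 : orth_basis_of conj V3 (fiber_span3 T')).
Let T := compression conj T' V1 V2 V3.

(** Each [V *m adjH conj V] fixes the fibers of [T'] in its mode, so applying [V1], [V2], [V3]
    undoes the compression. *)
Lemma decompression : T' = mode3 (mode2 (mode1 T V1) V2) V3.
Proof.
rewrite /T /compression mode13 mode12 mode11 (mode1_proj o1.1 o1.2).
by rewrite mode23 mode22 (mode2_proj o2.1 o2.2) mode33 (mode3_proj o3.1 o3.2).
Qed.

(** For a common kernel vector [x], the row [W] annihilates all mode-2 fibers of [T'], hence the
    columns of [V2], which lie in their span; but [W *m V2 = x^T]. *)
Lemma compression_nondegenerate_r : nondegenerate_r T.
Proof.
move=> x Tx; set W := x^T *m adjH conj V2.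
have T'W : mode2 T' W = fun _ _ _ => 0.
  rewrite decompression mode23 mode22 -mulmxA o2.1 mulmx1 -mode12.
  apply: eq_tensor => i j l; rewrite /mode3 big1// => m _.
  rewrite /mode1 big1 ?mulr0// => k _; rewrite [X in _ * X](_ : _ = 0) ?mulr0//.
  have /colP/(_ k) := Tx m; rewrite !mxE => xk; rewrite -{}[RHS]xk.
  by apply: eq_bigr => b _; rewrite !mxE mulrC ord1.
have /mul_fiber_span2/sub_kermxP SW : forall i l, \row_j T' i j l *m W^T = 0.
  move=> i l; apply/rowP => j; rewrite ord1 !mxE.
  transitivity (mode2 T' W i 0 l); last by rewrite T'W.
  by apply: eq_bigr => b _; rewrite !mxE mulrC.
have [_ /andP[VS _]] := o2; have /sub_kermxP := submx_trans VS SW.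
by rewrite -trmx_mul -mulmxA o2.1 mulmx1 trmxK.
Qed.

Lemma compression_nondegenerate_l : nondegenerate_l T.
Proof.
move=> y yT; set W := y *m adjH conj V1.
have T'W : mode1 T' W = fun _ _ _ => 0.
  rewrite decompression mode13 mode12 mode11 -mulmxA o1.1 mulmx1.
  apply: eq_tensor => i j l; rewrite /mode3 big1// => m _.
  rewrite /mode2 big1 ?mulr0// => k _; rewrite [X in _ * X](_ : _ = 0) ?mulr0//.
  have /rowP/(_ k) := yT m; rewrite !mxE => yk; rewrite -{}[RHS]yk.
  by apply: eq_bigr => b _; rewrite !mxE ord1.
have /mul_fiber_span1/sub_kermxP SW : forall j l, \row_i T' i j l *m W^T = 0.
  move=> i l; apply/rowP => j; rewrite ord1 !mxE.
  transitivity (mode1 T' W 0 i l); last by rewrite T'W.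
  by apply: eq_bigr => b _; rewrite !mxE mulrC.
have [_ /andP[VS _]] := o1; have /sub_kermxP := submx_trans VS SW.
rewrite -trmx_mul -mulmxA o1.1 mulmx1 => y0; apply: trmx_inj.
by rewrite y0 trmx0.
Qed.

Lemma compression_cpd n (A : 'M_(I1, n)) (B : 'M_(I2, n)) (C : 'M_(I3, n)) :
  compression conj (cpd A B C) V1 V2 V3 =
  cpd (adjH conj V1 *m A) (adjH conj V2 *m B) (adjH conj V3 *m C).
Proof. by rewrite /compression mode1_cpd mode2_cpd mode3_cpd. Qed.

(** Compressing a decomposition of [T'] gives square factors for modes 1 and 2, invertible by
    nondegeneracy. Conversely a decomposition of [T] is expanded by the [V] matrices, whose left
    inverses keep columns nonzero. *)
Lemma krank_compressionP : \rank (fiber_span1 T') = R ->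
  krank T' R <-> jge_vectors_span T.
Proof.
move=> r1; split=> [[[A [B [C [_ _ _ T'E]]]] _]|].
  have ndl := compression_nondegenerate_l; have ndr := compression_nondegenerate_r.
  have TE : T = cpd (adjH conj V1 *m A) (adjH conj V2 *m B) (adjH conj V3 *m C).
    by rewrite /T T'E compression_cpd.
  rewrite TE in ndl ndr *.
  exact: cpd_jge_vectors_span (cpd_unitl ndl) (cpd_unitr ndr).
move=> /(jge_vectors_span_cpd compression_nondegenerate_r).
move=> [A [B [C [nA nB nC TE]]]]; split; last first.
  by move=> m /mlrank1_le; rewrite r1.
have nzM m q n (V : 'M[K]_(m, q)) (U : 'M_(q, m)) (M : 'M_(q, n)) :
    U *m V = 1%:M -> nz_cols M -> nz_cols (V *m M).
  move=> UV nM r; apply: contra (nM r) => /eqP VM.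
  by rewrite -[col r M]mul1mx -UV -mulmxA -col_mul VM mulmx0.
exists (V1 *m A), (V2 *m B), (V3 *m C); split.
- exact: nzM o1.1 nA.
- exact: nzM o2.1 nB.
- exact: nzM o3.1 nC.
by rewrite decompression TE mode1_cpd mode2_cpd mode3_cpd.
Qed.

(** Compression is linear with fixed coefficients, hence continuous, and preserves the number of
    terms; padding and choice give factors of one shape for all [p]. *)
Lemma border_compression n : border_le T' n ->
  exists A B C, forall k,
    cvgm (fun p => slice (cpd (A p) (B p) (C p : 'M[K]_(Kd, n))) k) (slice T k).
Proof.
move=> [u [ur uT']].
have /choice[f fP] p : exists ABC : 'M_(R, n) * 'M_(R, n) * 'M_(Kd, n),
    compression conj (u p) V1 V2 V3 = cpd ABC.1.1 ABC.1.2 ABC.2.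
  have [r [rn [[A [B [C [_ _ _ ->]]]] _]]] := ur p; rewrite compression_cpd.
  have [A' [B' [C' ->]]] := cpd_pad (adjH conj V1 *m A) (adjH conj V2 *m B)
    (adjH conj V3 *m C) rn.
  by exists (A', B', C').
exists (fun p => (f p).1.1), (fun p => (f p).1.2), (fun p => (f p).2) => k i j.
rewrite mxE; apply: (@cvgs_ext _ (fun p => compression conj (u p) V1 V2 V3 i j k)).
  by move=> p; rewrite mxE fP.
do 3 (apply: cvgs_sum => ?; apply: cvgsM; first exact: cvgs_cst).
by move=> e /uT'[N uN]; exists N => p /uN.
Qed.

End Compression.

(** * Commutation relations that survive limits of simultaneous diagonalisations *)

Section SimultaneousDiagonalisation.
Variables (K : numFieldType) (n : nat).

(** All factors are invertible, so [W] is the inverse of [diag_mx m] and commutes with diagonal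
    matrices; both sides reduce to a product of commuting diagonals between [A] and [B]. *)
Lemma diag_mul_inv_comm (A B : 'M[K]_n) (m d e : 'rV[K]_n) :
  let M := A *m diag_mx m *m B in M \in unitmx ->
  (A *m diag_mx d *m B) *m invmx M *m (A *m diag_mx e *m B) =
  (A *m diag_mx e *m B) *m invmx M *m (A *m diag_mx d *m B).
Proof.
move=> M uM; have := uM; rewrite !unitmx_mul => /andP[/andP[uA _] _].
pose W := B *m invmx M *m A.
have mW : diag_mx m *m W = 1%:M.
  apply: (can_inj (mulKmx uA)); rewrite mulmx1 /W !mulmxA.
  by rewrite -/M mulmxV// mul1mx.
have Wm := mulmx1C mW.
have We f : W *m diag_mx f = diag_mx f *m W.
  rewrite -[LHS]mulmx1 -mW mulmxA -[W *m _ *m _]mulmxA diag_mxC.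
  by rewrite [W *m _]mulmxA Wm mul1mx.
have E f h : (A *m diag_mx f *m B) *m invmx M *m (A *m diag_mx h *m B) =
    A *m (diag_mx f *m W *m diag_mx h) *m B by rewrite /W !mulmxA.
rewrite !E -![_ *m W *m _]mulmxA !We.
by rewrite [diag_mx d *m _]mulmxA diag_mxC -[diag_mx e *m _ *m _]mulmxA.
Qed.

Variables (Kd : nat) (Tp : nat -> 'I_Kd -> 'M[K]_n) (T : 'I_Kd -> 'M[K]_n).
Variable g : 'I_Kd -> K.
Let M := \sum_k g k *: T k.
Hypotheses
  (TpE : forall p, exists A B (c : 'I_Kd -> 'rV_n),
     forall k, Tp p k = A *m diag_mx (c k) *m B)
  (TpT : forall k, cvgm (Tp^~ k) (T k)) (uM : M \in unitmx).

(** The limit is taken with [\adj] instead of the inverse, since the adjugate is polynomial in the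
    entries and so continuous. The two differ by a scalar wherever [\det (Mp p)] is nonzero, which
    holds eventually. *)
Lemma limit_slices_commute k l :
  T k *m invmx M *m T l = T l *m invmx M *m T k.
Proof.
pose Mp p := \sum_k g k *: Tp p k.
have MpM : cvgm Mp M by exact: cvgm_sumZ.
have [|N MpN] := cvgs_eventually_neq0 (cvgm_det MpM).
  by rewrite -unitfE -unitmxE.
have adjC p : (N <= p)%N ->
    Tp p k *m \adj (Mp p) *m Tp p l = Tp p l *m \adj (Mp p) *m Tp p k.
  move=> /MpN d0; have uMp : Mp p \in unitmx by rewrite unitmxE unitfE.
  have -> : \adj (Mp p) = \det (Mp p) *: invmx (Mp p).
    by rewrite /invmx uMp scalerA divff// scale1r.
  have [A [B [c cE]]] := TpE p.
  have ME : Mp p = A *m diag_mx (\sum_k g k *: c k) *m B.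
    rewrite linear_sum /= mulmx_sumr mulmx_suml; apply: eq_bigr => j _.
    by rewrite linearZ /= -scalemxAr -scalemxAl -cE.
  rewrite -!scalemxAr -!scalemxAl !cE ME diag_mul_inv_comm//.
  by rewrite -ME.
have adjT : T k *m \adj M *m T l = T l *m \adj M *m T k.
  apply/matrixP => i j; apply/eqP; rewrite -subr_eq0; apply/eqP.
  have cv a b := cvgm_mul (cvgm_mul (TpT a) (cvgm_adj MpM)) (TpT b).
  apply: (cvgs_eq0 (cvgsD (cv k l i j) (cvgsN (cv l k i j)))).
  by apply: (cvgs_eventually0 (N := N)) => p /adjC ->; rewrite subrr.
by rewrite /invmx uM -!scalemxAr -!scalemxAl adjT.
Qed.

End SimultaneousDiagonalisation.

(** * Joint eigenspaces of commuting matrices acting on row vectors *)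

Section JointEigenspaces.
Variables (K : numFieldType) (n Kd : nat) (S : 'I_Kd -> 'M[K]_n).
Hypothesis comS : forall k l, S k *m S l = S l *m S k.

Definition joint_eigenspace (nu : 'rV[K]_Kd) : 'M[K]_n :=
  (\bigcap_(k < Kd) eigenspace (S k) (nu 0 k))%MS.

Lemma joint_eigenspaceP (nu : 'rV_Kd) m (x : 'M[K]_(m, n)) :
  reflect (forall k, x *m S k = nu 0 k *: x) (x <= joint_eigenspace nu)%MS.
Proof.
apply: (iffP sub_bigcapmxP) => [h k|h k _]; first exact/eigenspaceP/h.
exact/eigenspaceP.
Qed.

Section Quotient.
Variables (s : nat) (X : 'M[K]_(s, n)).
Hypothesis stX : forall k, (X *m S k <= X)%MS.

Lemma sub_mulS m (v : 'M_(m, n)) k : (v <= X)%MS -> (v *m S k <= X)%MS.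
Proof. by move=> vX; apply: submx_trans (stX k); apply: submxMr. Qed.

(** The fold applies the factors [S k - x] in turn. It starts outside [X] and ends inside, so the
    vector just before it first enters is an eigenvector of [S k] modulo [X]; commutation preserves
    the relations for [ks]. *)
Lemma eigen_mod_step (nu : 'I_Kd -> K) (ks : seq 'I_Kd) k (a : seq K) (v : 'rV_n) :
  ~~ (v <= X)%MS -> {in ks, forall j, (v *m S j - nu j *: v <= X)%MS} ->
  (foldl (fun v x => v *m S k - x *: v) v a <= X)%MS ->
  exists (v' : 'rV_n) x, [/\ ~~ (v' <= X)%MS, (v' *m S k - x *: v' <= X)%MS
    & {in ks, forall j, (v' *m S j - nu j *: v' <= X)%MS}].
Proof.
elim: a v => [|x a IH] v vX vks /=; first by rewrite (negPf vX).
have [v1X _|v1X] := boolP (v *m S k - x *: v <= X)%MS; first by exists v, x.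
apply: IH => // j /vks vj.
have -> : (v *m S k - x *: v) *m S j - nu j *: (v *m S k - x *: v) =
    (v *m S j - nu j *: v) *m S k - x *: (v *m S j - nu j *: v).
  rewrite !mulmxBl -!mulmxA [S k *m _]comS !scalerBr -!scalemxAl !scalerA.
  by rewrite [x * _]mulrC addrAC [RHS]addrAC !opprB !addrA addrAC.
by rewrite addmx_sub ?eqmx_opp ?scalemx_sub// sub_mulS.
Qed.

Hypothesis annS : forall k, exists a : seq K, forall v : 'rV_n,
  foldl (fun v x => v *m S k - x *: v) v a = 0.

(** Starting from a unit vector outside [X], the matrices are treated one at a time; each round adds
    one eigenvalue modulo [X] and keeps the former ones. *)
Lemma ex_eigen_mod : ~~ row_full X -> exists (v : 'rV_n) (nu : 'rV_Kd),
  ~~ (v <= X)%MS /\ forall k, (v *m S k - nu 0 k *: v <= X)%MS.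
Proof.
rewrite -sub1mx => /row_subPn[i0 vX].
suff [v [nu [v1 v2]]] : exists (v : 'rV_n) (nu : 'I_Kd -> K), ~~ (v <= X)%MS /\
    {in enum 'I_Kd, forall k, (v *m S k - nu k *: v <= X)%MS}.
  by exists v, (\row_k nu k); split=> // k; rewrite mxE v2 ?mem_enum.
elim: (enum _) => [|k ks [v [nu [v1 v2]]]].
  by exists (row i0 1%:M), (fun=> 0).
have [a /(_ v) av] := annS k.
have [|v' [x [v'X v'k v'ks]]] := @eigen_mod_step nu ks k a v v1 v2.
  by rewrite av sub0mx.
exists v', (fun j => if j == k then x else nu j); split=> // j.
by rewrite inE; case: eqVneq => [->|] //= _; apply: v'ks.
Qed.

End Quotient.

Hypothesis annS : forall k, exists a : seq K, forall v : 'rV_n,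
  foldl (fun v x => v *m S k - x *: v) v a = 0.

(* If [v] is an eigenvector modulo the span of the joint eigenvectors, then
   commutativity lets one cancel the components of [v (S k) - nu k v] along
   joint eigenvalues different from [nu]. *)
Lemma joint_eigen_defect s (X : 'M[K]_(s, n)) :
  row_free X -> (forall i, exists mu : 'rV_Kd, (row i X <= joint_eigenspace mu)%MS) ->
  (forall (x : 'rV_n) (nu : 'rV_Kd), x != 0 -> (x <= joint_eigenspace nu)%MS -> (x <= X)%MS) ->
  ~~ row_full X ->
  exists (v : 'rV_n) (nu : 'rV_Kd), [/\ joint_eigenspace nu != 0, ~~ (v <= joint_eigenspace nu)%MS
    & forall k, (v *m S k - nu 0 k *: v <= joint_eigenspace nu)%MS].
Proof.
move=> fX /fin_all_exists[mu muP] maxX nfX.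
pose D k := diag_mx (\row_i mu i 0 k).
have XS k : X *m S k = D k *m X.
  apply/row_matrixP => i; rewrite row_mul.
  have /joint_eigenspaceP -> := muP i.
  by apply/rowP => j; rewrite mul_diag_mx !mxE.
have stX k : (X *m S k <= X)%MS by rewrite XS submxMl.
have [v [nu [vX vS]]] := ex_eigen_mod stX annS nfX.
pose w k := (v *m S k - nu 0 k *: v) *m pinvmx X.
have wE k : v *m S k = nu 0 k *: v + w k *m X.
  by rewrite /w mulmxKpV// addrC subrK.
clearbody w.
(* This compares coordinate [i] of [v *m S k *m S l] and [v *m S l *m S k] in the basis [X]. *)
have wC k l i : w k 0 i * (mu i 0 l - nu 0 l) = w l 0 i * (mu i 0 k - nu 0 k).
  have : v *m S k *m S l = v *m S l *m S k by rewrite -!mulmxA comS.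
  rewrite !wE !mulmxDl -!scalemxAl !wE -!mulmxA !XS !mulmxA !scalerDr !scalerA.
  rewrite [nu 0 l * _]mulrC -!addrA => /addrI; rewrite !scalemxAl -!mulmxDl.
  move=> /(row_free_inj fX)/rowP/(_ i); rewrite !mul_mx_diag !mxE => e.
  rewrite !mulrBr ![w _ 0 i * nu 0 _]mulrC.
  by apply/eqP; rewrite subr_eq addrAC eq_sym subr_eq addrC -e addrC.
(* If [mu i] and [nu] differ at [l], the quotient formed at [l] serves every [k], by [wC]. *)
have /fin_all_exists[c cP] i : exists c, mu i = nu \/
    forall k, w k 0 i = c * (mu i 0 k - nu 0 k).
  have [->|/eqP mn] := eqVneq (mu i) nu; first by exists 0; left.
  have [l ml] : exists l, mu i 0 l - nu 0 l != 0.
    apply/existsP; apply: contra_notT mn; rewrite negb_exists => /forallP h.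
    by apply/rowP => l; apply/eqP; rewrite -subr_eq0 -[_ == _]negbK h.
  exists (w l 0 i / (mu i 0 l - nu 0 l)); right=> k.
  by rewrite mulrAC -wC mulfK.
(* Along rows with [mu i] different from [nu] the remainder now cancels; rows with [mu i = nu] lie
   in the joint eigenspace of [nu]. *)
pose v' := v - (\row_i c i) *m X.
have v'X : ~~ (v' <= X)%MS.
  apply: contra vX => v'X; rewrite -[v](subrK ((\row_i c i) *m X)).
  by rewrite addmx_sub// submxMl.
have v'S k : (v' *m S k - nu 0 k *: v' <= joint_eigenspace nu)%MS.
  have -> : v' *m S k - nu 0 k *: v' =
      (\row_i (w k 0 i - c i * (mu i 0 k - nu 0 k))) *m X.
    have -> : \row_i (w k 0 i - c i * (mu i 0 k - nu 0 k)) =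
        w k - (\row_i c i *m D k - nu 0 k *: \row_i c i).
      apply/rowP => i; rewrite mul_mx_diag !mxE mulrBr.
      by rewrite [nu 0 k * _]mulrC.
    rewrite /v' !mulmxBl wE -!mulmxA XS !mulmxA scalerBr -scalemxAl.
    by rewrite !opprB addrA [LHS](ACl (2 * (4 * 3) * 1 * 5))/= addrK scalemxAl.
  rewrite mulmx_sum_row; apply: summx_sub => i _; rewrite mxE.
  case: (cP i) => [<-|->]; first by rewrite scalemx_sub.
  by rewrite subrr scale0r sub0mx.
exists v', nu; split=> //; last first.
  apply: contra v'X => v'E; have [->|v'0] := eqVneq v' 0; first exact: sub0mx.
  exact: maxX v'0 v'E.
(* Were the eigenspace zero, all remainders would vanish, making [v'] zero or a joint eigenvector,
   hence in the span of [X]. *)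
apply: contra v'X => /eqP E0.
have [->|v'0] := eqVneq v' 0; first exact: sub0mx.
apply: (maxX _ nu v'0); apply/joint_eigenspaceP => k.
apply/eqP; rewrite -subr_eq0 -submx0.
by rewrite -E0 v'S.
Qed.

End JointEigenspaces.

(** The fold is [v] times the factored characteristic polynomial evaluated at [A], so
    Cayley-Hamilton applies. *)
Lemma char_poly_split_annihilates (K : fieldType) n (A : 'M[K]_n) (a : seq K) :
  char_poly A = \prod_(x <- a) ('X - x%:P) ->
  forall v : 'rV_n, foldl (fun v x => v *m A - x *: v) v a = 0.
Proof.
case: n A => [|n] A cA v; first by rewrite thinmx0.
have -> : foldl (fun v x => v *m A - x *: v) v a =
    v *m horner_mx A (\prod_(x <- a) ('X - x%:P)).
  elim: {cA} a v => [|x a IH] v /=; first by rewrite big_nil rmorph1 mulmx1.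
  rewrite IH big_cons rmorphM /= rmorphB /= horner_mx_X horner_mx_C.
  by rewrite mulmxA mulmxBr mul_mx_scalar.
by rewrite -cA Cayley_Hamilton mulmx0.
Qed.

(** * Pencils of linear forms and divisors of their determinants *)

Section Pencil.
Variables (K : numFieldType) (Kd : nat).

(** Rectangular shapes are allowed so that the blocks of a block pencil are again pencils. *)
Definition pencil m n (S : 'I_Kd -> 'M[K]_(m, n)) : 'M[{mpoly K[Kd]}]_(m, n) :=
  \matrix_(i, j) \sum_k (S k i j)%:MP * 'X_k.

Lemma eq_pencil m n (S S' : 'I_Kd -> 'M[K]_(m, n)) : S =1 S' -> pencil S = pencil S'.
Proof.
by move=> e; apply/matrixP => i j; rewrite !mxE; apply: eq_bigr => k _; rewrite e.
Qed.

Lemma charpolyE R (T : tensor K R R Kd) : charpoly T = \det (pencil (slice T)).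
Proof.
congr (\det _); apply/matrixP => i j; rewrite !mxE.
by apply: eq_bigr => k _; rewrite mxE.
Qed.

Lemma pencil_mull m n q (A : 'M[K]_(m, n)) (S : 'I_Kd -> 'M[K]_(n, q)) :
  pencil (fun k => A *m S k) = map_mx (@mpolyC Kd K) A *m pencil S.
Proof.
apply/matrixP => i j; rewrite !mxE.
under [RHS]eq_bigr do rewrite !mxE mulr_sumr.
rewrite exchange_big /=; apply: eq_bigr => k _.
rewrite !mxE rmorph_sum mulr_suml; apply: eq_bigr => r _.
by rewrite rmorphM mulrA.
Qed.

Lemma pencil_mulr m n q (S : 'I_Kd -> 'M[K]_(m, n)) (A : 'M[K]_(n, q)) :
  pencil (fun k => S k *m A) = pencil S *m map_mx (@mpolyC Kd K) A.
Proof.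
apply/matrixP => i j; rewrite !mxE.
under [RHS]eq_bigr do rewrite !mxE mulr_suml.
rewrite exchange_big /=; apply: eq_bigr => k _.
rewrite !mxE rmorph_sum mulr_suml; apply: eq_bigr => r _.
by rewrite rmorphM mulrAC.
Qed.

Lemma pencil_tr m n (S : 'I_Kd -> 'M[K]_(m, n)) :
  pencil (fun k => (S k)^T) = (pencil S)^T.
Proof.
by apply/matrixP => i j; rewrite !mxE; apply: eq_bigr => k _; rewrite !mxE.
Qed.

Lemma pencil_scalar n (nu : 'rV[K]_Kd) :
  pencil (fun k => (nu 0 k)%:M : 'M_n) = (linform nu)%:M.
Proof.
apply/matrixP => i j; rewrite !mxE; have [->|ij] := eqVneq i j.
  by rewrite mulr1n; apply: eq_bigr => k _; rewrite mxE eqxx mulr1n.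
by rewrite mulr0n big1// => k _; rewrite mxE (negPf ij) mulr0n raddf0 mul0r.
Qed.

Lemma pencil_lblock m n (A : 'I_Kd -> 'M[K]_m) (B : 'I_Kd -> 'M[K]_(n, m))
    (C : 'I_Kd -> 'M[K]_n) :
  pencil (fun k => block_mx (A k) 0 (B k) (C k)) =
  block_mx (pencil A) 0 (pencil B) (pencil C).
Proof.
apply/matrixP => i j; rewrite mxE; case: (splitP i) => i' ii';
case: (splitP j) => j' jj'.
all: rewrite (_ : i = lshift n i') || rewrite (_ : i = rshift m i') //; try exact: val_inj.
all: rewrite (_ : j = lshift n j') || rewrite (_ : j = rshift m j') //; try exact: val_inj.
- by rewrite block_mxEul mxE; apply: eq_bigr => k _; rewrite block_mxEul.
- rewrite block_mxEur mxE big1// => k _.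
  by rewrite block_mxEur mxE raddf0 mul0r.
- by rewrite block_mxEdl mxE; apply: eq_bigr => k _; rewrite block_mxEdl.
- by rewrite block_mxEdr mxE; apply: eq_bigr => k _; rewrite block_mxEdr.
Qed.

Lemma complete_row_free m t (X : 'M[K]_(m, m + t)) : row_free X ->
  exists Y : 'M[K]_(t, m + t), col_mx X Y \in unitmx.
Proof.
(* The rows of [X] span the same space as the first [m] rows of the invertible [row_ebase X]; its
   last [t] rows complete them. *)
move=> fX; exists (row_mx 0 1%:M *m row_ebase X).
have XE : X = row_mx (col_ebase X) 0 *m row_ebase X.
  rewrite -{1}(mulmx_ebase X) (eqP fX) pid_mx_row mul_mx_row mulmx1.
  by rewrite mulmx0.
rewrite {1}XE -mul_col_mx -block_mxEv unitmx_mul row_ebase_unit andbT.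
by rewrite unitmxE det_lblock det1 mulr1 -unitmxE col_ebase_unit.
Qed.

(** The rows of [X] span a subspace stable under all [S k]. In a basis extending [X], every [S k] is
    block lower triangular with corner [L k], so the determinant factors. *)
Lemma pencil_dvd m n (S : 'I_Kd -> 'M[K]_n) (L : 'I_Kd -> 'M[K]_m)
    (X : 'M[K]_(m, n)) : row_free X -> (forall k, X *m S k = L k *m X) ->
  mdvd (\det (pencil L)) (\det (pencil S)).
Proof.
move=> fX; have mn : (m <= n)%N by rewrite -(eqP fX) rank_leq_col.
move: S X fX; rewrite -(subnKC mn); move: (n - m)%N => t {n mn} S X fX XS.
have [Y uP] := complete_row_free fX; set P := col_mx X Y in uP.
pose Z k := Y *m S k *m invmx P.
have PS k : P *m S k = block_mx (L k) 0 (lsubmx (Z k)) (rsubmx (Z k)) *m P.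
  rewrite [in RHS]/P mul_block_col mul0mx addr0 -XS -mul_row_col hsubmxK -/P.
  by rewrite /Z mulmxKV// mul_col_mx.
have /(congr1 determinant) : map_mx (@mpolyC Kd K) P *m pencil S =
    block_mx (pencil L) 0 (pencil (fun k => lsubmx (Z k)))
      (pencil (fun k => rsubmx (Z k))) *m map_mx (@mpolyC Kd K) P.
  by rewrite -pencil_mull (eq_pencil PS) pencil_mulr pencil_lblock.
rewrite !det_mulmx det_lblock mulrC => /mulIf e.
exists (\det (pencil (fun k => rsubmx (Z k)))); rewrite [RHS]mulrC; apply: e.
by rewrite det_map_mx mpolyC_eq0 -unitfE -unitmxE.
Qed.

Lemma meval_linform (lam : 'rV[K]_Kd) (v : 'I_Kd -> K) :
  meval v (linform lam) = \sum_k lam 0 k * v k.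
Proof.
rewrite rmorph_sum /=; apply: eq_bigr => k _.
by rewrite mevalM mevalC mevalXU.
Qed.

Lemma linform_eq0 (lam : 'rV[K]_Kd) : (linform lam == 0) = (lam == 0).
Proof.
apply/eqP/eqP => [l0|->]; last by apply: big1 => k _; rewrite mxE raddf0 mul0r.
apply/rowP => k; have /(congr1 (meval (fun j => (j == k)%:R))) := l0.
rewrite meval_linform meval0 (bigD1 k)//= eqxx mulr1 big1 ?addr0 ?mxE//.
by move=> j /negPf ->; rewrite mulr0.
Qed.

Lemma linformZ c (lam : 'rV[K]_Kd) : linform (c *: lam) = c%:MP * linform lam.
Proof.
rewrite mulr_sumr; apply: eq_bigr => k _.
by rewrite mxE rmorphM mulrA.
Qed.

(** A nonzero linear form is not constant, so its powers grow in degree; this bounds the exponents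
    in [ex_am]. *)
Lemma msize_linformX (lam : 'rV[K]_Kd) m : lam != 0 -> (m < msize (linform lam ^+ m))%N.
Proof.
move=> lam0; have l0 : linform lam != 0 by rewrite linform_eq0.
have l1 : (1 < msize (linform lam))%N.
  rewrite ltnNge; apply: contra l0 => /msize1_polyC lE.
  rewrite lE mpolyC_eq0; have /(congr1 (meval (fun=> 0))) := lE.
  by rewrite meval_linform mevalC big1 => [<-//|k _]; rewrite mulr0.
elim: m => [|m IH]; first by rewrite expr0 msize1.
rewrite exprS msizeM ?expf_neq0//; case: (msize (linform _)) l1 => // s s1.
by rewrite addSn /= -[m.+2]add1n leq_add.
Qed.

Lemma ex_am R (T : tensor K R R Kd) lam m : lam != 0 -> charpoly T != 0 ->
  mdvd (linform lam ^+ m) (charpoly T) -> exists m', am T lam m' /\ (m <= m')%N.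
Proof.
move=> lam0 T0 dm.
pose Q j := `[< mdvd (linform lam ^+ j) (charpoly T) >].
have Qb j : Q j -> (j <= msize (charpoly T))%N.
  move=> /asboolP[q qE]; have := T0; rewrite qE mulf_eq0 negb_or => /andP[q0 l0].
  rewrite msizeM//; case: (msize q) (msize_poly_eq0 q) => [|s].
    by rewrite (negPf q0) eqxx.
  by rewrite addSn /= => _; rewrite (leq_trans (ltnW (msize_linformX j lam0)))// leq_addl.
have exQ : exists j, Q j by exists m; apply/asboolP.
case: (ex_maxnP exQ Qb) => j /asboolP Qj jmax; exists j; split; last exact/jmax/asboolP.
by split=> // /asboolP/jmax; rewrite ltnn.
Qed.

(** In characteristic zero the [size p] integers tried are distinct, too many to be all roots. *)
Lemma ex_not_root (p : {poly K}) : p != 0 -> exists x, p.[x] != 0.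
Proof.
move=> p0; pose rs := [seq i%:R : K | i <- iota 0 (size p)].
have urs : uniq rs by rewrite map_inj_uniq ?iota_uniq//; exact: mulrIn (oner_neq0 K).
have [rsp|/allPn[x _ px]] := boolP (all (root p) rs); last by exists x.
by have := max_poly_roots p0 rsp urs; rewrite size_map size_iota ltnn.
Qed.

(* A generic point of the hyperplane [lam = 0] is taken on a moment curve. *)
Lemma linform_dvd_prod (I : finType) (P : pred I) (ls : I -> 'rV[K]_Kd) lam :
  mdvd (linform lam) (\prod_(r | P r) linform (ls r)) ->
  exists2 r, P r & (ls r <= lam)%MS.
Proof.
move=> [q qE]; apply: contrapT => nls.
(* The columns of [Z] span the hyperplane [lam = 0]. The value of [f r] at [t] is that of
   [linform (ls r)] at the image under [Z] of the moment vector of [t]; [f r] vanishes identically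
   only if [ls r] is a multiple of [lam]. *)
pose Z := cokermx lam.
pose f r : {poly K} := \poly_(i < Kd) (if insub i is Some j then (ls r *m Z) 0 j else 0).
have f0 r : P r -> f r != 0.
  move=> Pr; apply: contra_notN nls => /eqP fr0; exists r => //.
  rewrite submxE; apply/eqP/rowP => j; have /polyP/(_ j) := fr0.
  by rewrite coef_poly ltn_ord valK coef0 => ->; rewrite mxE.
have /ex_not_root[t ft] : \prod_(r | P r) f r != 0 by apply/prodf_neq0.
pose v := Z *m \col_i t ^+ i.
have ev (l : 'rV_Kd) : meval (fun k => v k 0) (linform l) = (l *m v) 0 0.
  by rewrite meval_linform mxE.
have /(congr1 (meval (fun k => v k 0))) := qE.
rewrite mevalM ev {2}/v mulmxA mulmx_coker mul0mx mxE mulr0 rmorph_prod /=.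
move/eqP; apply/negP; apply: contra ft; rewrite horner_prod.
apply: contraLR => ft; have {}ft r : P r -> (f r).[t] != 0.
  by move=> Pr; move: ft; move/prodf_neq0 => /(_ r Pr).
apply/prodf_neq0 => r Pr; rewrite ev.
rewrite (_ : _ 0 0 = (f r).[t]) ?ft// horner_poly mulmxA mxE.
by apply: eq_bigr => i _; rewrite valK [X in _ * X]mxE.
Qed.

(** One factor [linform lam] forces some [ls r] to be proportional to [lam]; after cancelling it,
    the second forces another [ls s] with [s != r], against non-proportionality. *)
Lemma simple_squarefree R (T : tensor K R R Kd) lam : simple T ->
  charpoly T != 0 -> ~ mdvd (linform lam ^+ 2) (charpoly T).
Proof.
move=> [_ [ls [TE ls_np]]] T0 [q qE].
have lam0 : linform lam != 0.
  by apply: contra T0; rewrite qE => /eqP ->; rewrite expr2 !mulr0.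
have [|r _ /sub_rVP[c rc]] := @linform_dvd_prod _ predT ls lam.
  by exists (q * linform lam); rewrite -TE qE mulrA.
have c0 : c != 0.
  apply: contra T0 => /eqP c0; rewrite TE (bigD1 r)//= rc c0 scale0r.
  by have /eqP -> : linform (0 : 'rV[K]_Kd) == 0; rewrite ?linform_eq0// mul0r.
have [|s sr slam] := @linform_dvd_prod _ (fun s => s != r) ls lam.
  exists ((c^-1)%:MP * q); rewrite -mulrA.
  have : linform lam * (c%:MP * \prod_(s | s != r) linform (ls s)) =
      linform lam * (q * linform lam).
    transitivity (charpoly T); last by rewrite qE expr2 mulrCA.
    by rewrite mulrCA mulrA -linformZ -rc TE [RHS](bigD1 r).
  by move=> /(mulfI lam0) <-; rewrite mulrA -rmorphM mulVf// rmorph1 mul1r.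
have /negP := ls_np _ _ sr; apply; apply: (submx_trans slam).
by rewrite rc eqmx_scale.
Qed.

End Pencil.

(** * The dichotomy: spanning JGE vectors or a defective JGE value *)

Lemma char_poly_tr (K : comNzRingType) n (A : 'M[K]_n) : char_poly A^T = char_poly A.
Proof. by rewrite /char_poly -det_tr /char_poly_mx linearB /= tr_scalar_mx map_trmx trmxK. Qed.

(** This isolates the one point where the two scalar fields need different arguments. *)
Definition split_limits (K : numFieldType) :=
  forall n (Mp Tp : nat -> 'M[K]_n) (M T : 'M[K]_n),
    (forall p, exists A B (d e : 'rV_n),
       Mp p = A *m diag_mx d *m B /\ Tp p = A *m diag_mx e *m B) ->
    cvgm Mp M -> cvgm Tp T -> M \in unitmx ->
    exists a : seq K, char_poly (invmx M *m T) = \prod_(x <- a) ('X - x%:P).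

Section Defect.
Variables (K : numFieldType) (R Kd : nat) (T : tensor K R R Kd).
Variables (A B : nat -> 'M[K]_R) (C : nat -> 'M[K]_(Kd, R)).
Variable g : 'I_Kd -> K.
Let M := \sum_k g k *: slice T k.
Hypotheses (splitK : split_limits K)
  (ABC : forall k, cvgm (fun p => slice (cpd (A p) (B p) (C p)) k) (slice T k))
  (uM : M \in unitmx).

(** Transposition turns the column vectors of JGE pairs into the row vectors on which [eigenspace]
    works. *)
Let S k := (invmx M *m slice T k)^T.

Let comS k l : S k *m S l = S l *m S k.
Proof.
rewrite /S -!trmx_mul; congr trmx; rewrite -!mulmxA; congr (_ *m _).
rewrite !mulmxA; symmetry.
apply: (limit_slices_commute (Tp := fun p => slice (cpd (A p) (B p) (C p)))) => // p.
by exists (A p), (B p)^T, (fun k => row k (C p)) => j; rewrite slice_cpd.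
Qed.

Let annS k : exists a : seq K, forall v : 'rV_R,
  foldl (fun v x => v *m S k - x *: v) v a = 0.
Proof.
have [|a aE] := splitK (Mp := fun p => \sum_k g k *: slice (cpd (A p) (B p) (C p)) k)
  (Tp := fun p => slice (cpd (A p) (B p) (C p)) k) _ (cvgm_sumZ g ABC) (ABC k) uM.
  move=> p; exists (A p), (B p)^T, (\sum_k g k *: row k (C p)), (row k (C p)).
  split; last by rewrite slice_cpd.
  rewrite linear_sum /= mulmx_sumr mulmx_suml; apply: eq_bigr => j _.
  by rewrite linearZ /= -scalemxAr -scalemxAl slice_cpd.
by exists a; apply: char_poly_split_annihilates; rewrite char_poly_tr.
Qed.

Let sumS : \sum_k g k *: S k = 1%:M.
Proof.
rewrite -[RHS]trmx1 -(mulVmx uM) [in RHS]/M mulmx_sumr linear_sum /=.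
by apply: eq_bigr => k _; rewrite -scalemxAr linearZ.
Qed.

Let MS k (x : 'cV_R) : slice T k *m x = M *m (x^T *m S k)^T.
Proof. by rewrite trmx_mul !trmxK mulmxA mulmxA mulmxV// mul1mx. Qed.

(** Its value at [g] is [\det M]. *)
Lemma charpoly_neq0 : charpoly T != 0.
Proof.
rewrite charpolyE; apply: contraTneq uM => /(congr1 (meval g)).
rewrite -det_map_mx meval0 unitmxE unitfE => e; rewrite negbK -e.
apply/eqP; congr (\det _); apply/matrixP => i j; rewrite !mxE summxE rmorph_sum.
by apply: eq_bigr => k _; rewrite rmorphM /= mevalC mevalXU !mxE mulrC.
Qed.

(** The combination of the [S k] with coefficients [g] is the identity. The normalisation selects
    one representative on each JGE line. *)
Lemma joint_eigenvalue_normalised nu (x : 'rV_R) :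
  x != 0 -> (x <= joint_eigenspace S nu)%MS -> \sum_k g k * nu 0 k = 1.
Proof.
move=> x0 /joint_eigenspaceP xS; apply/eqP; rewrite -subr_eq0.
have : (\sum_k g k * nu 0 k - 1) *: x == 0.
  rewrite scalerBl scale1r subr_eq0 -[X in _ == X]mulmx1 -sumS mulmx_sumr.
  rewrite scaler_suml; apply/eqP; apply: eq_bigr => k _.
  by rewrite -scalemxAr xS scalerA.
by rewrite scaler_eq0 (negPf x0) orbF.
Qed.

Lemma joint_eigenvector_jge nu (x : 'rV_R) :
  x != 0 -> (x <= joint_eigenspace S nu)%MS -> jge_pair T nu x^T.
Proof.
move=> x0 /joint_eigenspaceP xS; have xT0 : x^T != 0 by rewrite trmx_eq0.
split=> //; exists (M *m x^T); split=> [|k].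
  apply: contra xT0 => /eqP/(congr1 (mulmx (invmx M))).
  by rewrite mulKmx// mulmx0 => ->.
by rewrite MS trmxK xS linearZ /= scalemxAr.
Qed.

(** Summing the equations with weights [g] gives [M *m x = c *: y], so [c] is nonzero and [y] can be
    eliminated. *)
Lemma jge_joint_eigenvector lam x : jge_pair T lam x ->
  let c := \sum_k g k * lam 0 k in
  c != 0 /\ (x^T <= joint_eigenspace S (c^-1 *: lam))%MS.
Proof.
move=> [x0 [y [y0 xy]]] c.
have Mx : M *m x = c *: y.
  rewrite mulmx_suml scaler_suml; apply: eq_bigr => k _.
  by rewrite -scalemxAl xy scalerA.
have c0 : c != 0.
  apply: contra x0 => /eqP c0; rewrite -(mulKmx uM x) Mx c0 scale0r mulmx0.
  exact: eqxx.
split=> //; apply/joint_eigenspaceP => k; apply: trmx_inj.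
apply: (can_inj (mulKmx uM)); rewrite -MS xy linearZ /= trmxK -scalemxAr Mx.
by rewrite !mxE scalerA mulrC mulrA divff// mul1r.
Qed.

Lemma jge_span_or_defect : jge_vectors_span T \/
  exists (lam : 'rV[K]_Kd) (m h : nat),
    [/\ lam != 0, jge_value T lam, am T lam m, gm T lam h & (1 <= h < m)%N].
Proof.
have [s [X [fX jX maxX]]] := ex_max_free (fun x : 'rV_R =>
  x != 0 /\ exists nu, (x <= joint_eigenspace S nu)%MS).
have [fullX|nfX] := boolP (row_full X); [left|right].
  move=> v; have /submxP[w vE] := submx_full v^T fullX.
  exists s, (fun i => (row i X)^T), (w 0); split=> [i|].
    by have [x0 [nu xnu]] := jX i; exists nu; apply: joint_eigenvector_jge.
  rewrite -[v]trmxK vE mulmx_sum_row linear_sum /=.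
  by apply: eq_bigr => i _; rewrite linearZ.
have [||v [nu [E0 vE vS]]] := joint_eigen_defect comS annS fX _ _ nfX.
- by move=> i; have [] := jX i.
- by move=> x nu x0 xnu; apply: maxX; split=> //; exists nu.
set E := joint_eigenspace S nu in E0 vE vS.
have E_rows i : row i (row_base E) != 0 /\ (row i (row_base E) <= E)%MS.
  split; last by rewrite (submx_trans (row_sub _ _))// eq_row_base.
  apply/eqP => ri0; have /row_freeP[Z XZ] := row_base_free E.
  have /rowP/(_ i)/eqP : row i (row_base E *m Z) = 0 by rewrite row_mul ri0 mul0mx.
  by rewrite XZ !mxE eqxx oner_eq0.
have rE : (0 < \rank E)%N by rewrite lt0n mxrank_eq0.
have [x0 xE] := E_rows (Ordinal rE).
have nu1 := joint_eigenvalue_normalised x0 xE.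
have nu0 : nu != 0.
  apply: contra_eq_neq nu1 => ->; rewrite big1 1?eq_sym ?oner_eq0// => k _.
  by rewrite mxE mulr0.
(* A JGE vector for the span of [nu] has some value [lam = a *: nu], whose weighted sum is [a];
   dividing by it returns [nu], so the vector lies in [E]. *)
have gmE : gm T nu (\rank E).
  exists (row_base E); split; first exact: row_base_free.
    move=> i; have [i0 iE] := E_rows i; exists nu.
    by split; [exact: joint_eigenvector_jge | rewrite submx_refl].
  move=> x [lam [/jge_joint_eigenvector[c0 xlam] /andP[/sub_rVP[a lamE] _]]].
  rewrite eq_row_base; move: c0 xlam; rewrite lamE.
  have -> : \sum_k g k * (a *: nu) 0 k = a.
    rewrite -[RHS]mulr1 -nu1 mulr_sumr; apply: eq_bigr => k _.
    by rewrite mxE mulrCA.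
  by move=> a0; rewrite scalerA mulVf// scale1r.
(* The rows of [row_base E] together with [v] span a stable subspace, on which each [S k] is lower
   triangular with constant diagonal [nu 0 k]. *)
have dvd : mdvd (linform nu ^+ (\rank E).+1) (charpoly T).
  have -> : linform nu ^+ (\rank E).+1 = \det (pencil (fun k => block_mx
      ((nu 0 k)%:M : 'M_(\rank E)) 0 ((v *m S k - nu 0 k *: v) *m pinvmx (row_base E))
      ((nu 0 k)%:M : 'M_1))).
    by rewrite pencil_lblock !pencil_scalar det_lblock !det_scalar exprSr.
  have [||q qE] := @pencil_dvd _ _ _ _ S (fun k => block_mx
      ((nu 0 k)%:M : 'M_(\rank E)) 0 ((v *m S k - nu 0 k *: v) *m pinvmx (row_base E))
      ((nu 0 k)%:M : 'M_1)) (col_mx (row_base E) v).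
  - apply: row_free_col_mx; first exact: row_base_free.
    by rewrite eq_row_base.
  - move=> k; rewrite mul_col_mx mul_block_col mul0mx addr0 !mul_scalar_mx.
    rewrite mulmxKpV ?eq_row_base// subrK.
    by have /joint_eigenspaceP -> : (row_base E <= E)%MS by rewrite eq_row_base.
  (* The pencil of [T] is [M] times that of the matrices [invmx M *m slice T k], hence the constant
     [\det M]. *)
  exists ((\det M)%:MP * q); rewrite -mulrA -qE charpolyE.
  rewrite -[S]/(fun k => (invmx M *m slice T k)^T) pencil_tr det_tr.
  rewrite -det_map_mx -det_mulmx -pencil_mull; congr (\det _); apply: eq_pencil => k.
  by rewrite mulKVmx.
have [m [amm lm]] := ex_am nu0 charpoly_neq0 dvd.
exists nu, m, (\rank E); split=> //; last by rewrite rE lm.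
exists nu, (row (Ordinal rE) (row_base E))^T; split; last by rewrite submx_refl.
exact: joint_eigenvector_jge.
Qed.

End Defect.

(** * The three claims, given the splitting of limits *)

Lemma theorem2p3_of_split_limits (K : numFieldType) (conj : K -> K) :
  split_limits K -> theorem2p3_for conj.
Proof.
move=> splitK I1 I2 I3 R Kd T' V1 V2 V3 [r1 _ _] o1 o2 o3 T.
have ndl : nondegenerate_l T := compression_nondegenerate_l o1 o2 o3.
have ndr : nondegenerate_r T := compression_nondegenerate_r o1 o2 o3.
have rkP : krank T' R <-> jge_vectors_span T := krank_compressionP o1 o2 o3 r1.
have defect : border_rank T' R -> slice_mix_invertible T ->
    charpoly T != 0 /\ (krank T' R \/ exists (lam : 'rV[K]_Kd) (m g : nat),
    [/\ lam != 0, jge_value T lam, am T lam m, gm T lam g & (1 <= g < m)%N]).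
  move=> [bT' _] [g uM].
  have [A [B [C ABC]]] := border_compression conj V1 V2 V3 bT'.
  split; first exact: (charpoly_neq0 uM).
  by case: (jge_span_or_defect splitK ABC uM) => [/rkP|]; [left|right].
split; [split=> // A B C _ TE|split].
- rewrite TE in ndl ndr *; have uA := cpd_unitl ndl; have uB := cpd_unitr ndr.
  split=> [L|r]; first exact: cpd_jge_value.
  by exists (col r C)^T; apply: cpd_jge_pair.
- move=> bT' sT; have [T0 [//|[lam [m [g [_ _ [[q qE] _] _ /andP[g0 gm]]]]]]] :=
    defect bT' sT.1.
  have [] := simple_squarefree sT T0 (lam := lam).
  (* From [1 <= g < m] the exponent is at least 2, so the square already divides. *)
  exists (q * linform lam ^+ (m - 2)); rewrite -mulrA -exprD subnK//.
  exact: leq_ltn_trans g0 gm.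
- move=> bT' [n [[_ nmin] Rn]] uT; have [_ [[/nmin nR _]|//]] := defect bT' uT.
  by move: Rn; rewrite ltnNge nR.
Qed.

(** * Splitting of limits over the real and complex numbers *)

Section RealAndComplex.
Variable R : realType.
Local Notation c := (real_complex R).
Local Notation Re := (@complex.Re (Real.sort R)).
Local Notation Im := (@complex.Im (Real.sort R)).

Lemma split_limits_complex : split_limits (R[i] : numFieldType).
Proof.
move=> n Mp Tp M T _ _ _ _.
have [r rE] := closed_field_poly_normal (char_poly (invmx M *m T)).
by exists r; rewrite rE (monicP (char_poly_monic _)) scale1r.
Qed.

Lemma normc_real (x : R) : `|c x| = c `|x|.
Proof. by rewrite normc_def /= expr0n addr0 sqrtr_sqr. Qed.

Lemma normc_ge_Im (z : R[i]) : c `|Im z| <= `|z|.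
Proof.
rewrite normc_def lecR -sqrtr_sqr ler_sqrt ?addr_ge0 ?sqr_ge0//.
by rewrite lerDr sqr_ge0.
Qed.

(** A positive [e] in [R[i]] has zero imaginary part, so its real part serves as the real bound. *)
Lemma cvgs_real_complex (u : nat -> R) l : cvgs u l -> cvgs (c \o u) (c l).
Proof.
move=> ul e; rewrite ltcE => /andP[/eqP Ime Ree].
have [N uN] := ul _ Ree; exists N => p /uN up.
by rewrite /= -rmorphB normc_real ltcE /= Ime eqxx.
Qed.

(* If every eigenvalue of the real pencil [(M, T)] is real, then
   [|det (z M - T)| >= |det M| |Im z| ^ n]; this bound survives limits. *)
Lemma split_limits_real : split_limits (R : numFieldType).
Proof.
move=> n Mp Tp M T MTp MpM TpT uM.
pose mc := @map_mx _ _ c n n.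
pose N := invmx M *m T.
have [r rE] := closed_field_poly_normal (map_poly c (char_poly N)).
have {rE} : map_poly c (char_poly N) = \prod_(z <- r) ('X - z%:P).
  by rewrite {1}rE (monicP (monic_map _ (char_poly_monic _))) scale1r.
move=> rE.
have Imr z : z \in r -> Im z = 0.
  move=> zr; apply/eqP; apply: contraTT (uM) => Imz.
  have /eqP z0 : \det (z *: mc M - mc T) == 0.
    have : root (char_poly (map_mx c N)) z by rewrite -map_char_poly rE root_prod_XsubC.
    rewrite -eigenvalue_root_char => /eigenvalueP[v vN v0].
    have uMc : mc M \in unitmx by rewrite map_unitmx.
    apply/det0P; exists (v *m invmx (mc M)).
      apply: contra v0 => /eqP/(congr1 (mulmxr (mc M))) /=.
      by rewrite mulmxKV// mul0mx => ->.
    rewrite mulmxBr -scalemxAr mulmxKV// -mulmxA -map_invmx -map_mxM vN.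
    by rewrite subrr.
  pose f p := \det (z *: mc (Mp p) - mc (Tp p)).
  pose h p := c (\det (Mp p)) * c `|Im z| ^+ n.
  (* Both matrices share the factors [A] and [B]. Each diagonal entry of [z *: d - e] has imaginary
     part [d 0 i * Im z], which bounds its modulus from below. *)
  have hf p : `|h p| <= `|f p|.
    rewrite /h /f; have [A [B [d [e [-> ->]]]]] := MTp p.
    have -> : z *: mc (A *m diag_mx d *m B) - mc (A *m diag_mx e *m B) =
        mc A *m diag_mx (z *: map_mx c d - map_mx c e) *m mc B.
      rewrite /mc !map_mxM !map_diag_mx [diag_mx (_ - _)]raddfB /= linearZ /=.
      by rewrite mulmxBr mulmxBl -scalemxAr -scalemxAl.
    rewrite !det_mulmx !rmorphM !det_diag !det_map_mx !normrM.
    rewrite -!mulrA ler_wpM2l// mulrCA [leRHS]mulrC ler_wpM2l//.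
    rewrite rmorph_prod normrX !normr_prod normc_real normr_id -[n in _ ^+ n]card_ord.
    rewrite -prodr_const -big_split /=; apply: ler_prod => i _.
    rewrite normc_real -rmorphM -normrM ler0c normr_ge0 /=.
    have -> : d 0 i * Im z = Im ((z *: map_mx c d - map_mx c e) 0 i).
      by rewrite !mxE; case: (z) => a b /=; rewrite mulr0 add0r subr0 mulrC.
    exact: normc_ge_Im.
  have mcP (X : nat -> 'M[R]_n) L : cvgm X L -> cvgm (mc \o X) (mc L).
    move=> XL i j; rewrite mxE; apply: cvgs_ext (cvgs_real_complex (XL i j)) => p.
    by rewrite /= mxE.
  have f0 : cvgs f 0.
    rewrite -z0; apply: cvgm_det => i j; rewrite !mxE.
    apply: cvgs_ext (_ : cvgs (fun p => z * c (Mp p i j) - c (Tp p i j)) _).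
      by move=> p; rewrite !mxE.
    apply: cvgsD; last exact/cvgsN/cvgs_real_complex/TpT.
    by apply: cvgsM; [exact: cvgs_cst | exact/cvgs_real_complex/MpM].
  have h0 : cvgs h 0.
    move=> e /f0[N0 fN]; exists N0 => p /fN; rewrite !subr0.
    exact: le_lt_trans.
  have hl : cvgs h (c (\det M) * c `|Im z| ^+ n).
    apply: cvgsM; last exact: cvgs_cst.
    exact/cvgs_real_complex/cvgm_det.
  have /eqP := cvgs_eq0 hl h0.
  rewrite mulf_eq0 expf_eq0 !fmorph_eq0 normr_eq0 (negPf Imz) andbF orbF.
  by rewrite unitmxE unitfE negbK.
(* All roots being real, [Re] loses nothing, and the factorisation descends because [map_poly c] is
   injective. *)
exists [seq Re z | z <- r]; apply: (map_poly_inj c); rewrite rE.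
rewrite rmorph_prod big_map /=; apply: eq_big_seq => z /Imr zr.
rewrite rmorphB /= map_polyX map_polyC /=; congr (_ - _%:P).
by case: z zr => a b /= ->.
Qed.

End RealAndComplex.

(* K = R (conjugation = identity) and K = C = R[i] (complex conjugation) *)
Theorem theorem2p3 (R : realType) :
  @theorem2p3_for (R : numFieldType) idfun /\
  @theorem2p3_for (R[i] : numFieldType) (fun z : R[i] => z^*).
Proof.
split; apply: theorem2p3_of_split_limits.
  exact: split_limits_real.
exact: split_limits_complex.
Qed.
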